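(* Let $p$ be a prime and $k\in\mathbb{N}$. Then $g(p^k,0)=p^{8(k-1)}\,g(p,0)$.
   Context: $\mathbb{N}$ denotes the positive integers and $\mathbb{Z}_n=\mathbb{Z}/n\mathbb{Z}$. $GL_3(\mathbb{Z}_n)$ is the group of invertible $3\times 3$ matrices over $\mathbb{Z}_n$. For a $3\times 3$ matrix $M=[m_{ij}]$, the permanent is $\mathrm{perm}(M)=\sum_{\sigma\in S_3}\prod_{i=1}^3 m_{i\sigma(i)}$. For a positive integer $n$ and an integer $x$, $g(n,x)$ denotes the cardinality of the set $G(n,x)=\{M\in GL_3(\mathbb{Z}_n)\mid \mathrm{perm}(M)\equiv x \pmod n\}$. *)

(* Defs.v *)
From mathcomp Require Import all_boot all_order all_fingroup all_algebra.

Set Implicit Arguments.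
Unset Strict Implicit.
Unset Printing Implicit Defensive.

Import GRing.Theory.
Local Open Scope ring_scope.

Definition permanent (R : comNzRingType) (m : nat) (A : 'M[R]_m) : R :=
  \sum_(s : 'S_m) \prod_(i < m) A i (s i).

(* Meaningful for 1 < n only: 'Z_n is Z/nZ when 1 < n, whereas 'Z_0 and 'Z_1
   both denote Z/2Z. The congruence modulo n is equality in 'Z_n. *)
Definition G (n : nat) (x : int) : {set {'GL_3['Z_n]}} :=
  [set M : {'GL_3['Z_n]} | permanent (GLval M) == x%:~R].

Definition g (n : nat) (x : int) : nat := #|G n x|.

(* Main.v *)
Require Import Defs.
From mathcomp Require Import all_boot all_order all_fingroup all_algebra.
From HB Require Import structures.
From mathcomp Require Import ring.

(* The permanent is affine in each entry, with slope the complementary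
   permanental minor.  Modulo p, an invertible matrix has a nonzero such minor;
   fix one for each invertible matrix over F_p of permanent 0.  A matrix M over
   Z/p^k reducing to such a matrix has permanent in the ideal (p) and its chosen
   minor is a unit, so exactly one change of that entry by an element t of (p)
   makes the permanent vanish.  Hence g(p^k,0) * #(p) counts the lifts of
   G(p,0), i.e. equals p^(9(k-1)) g(p,0), where #(p) = p^(k-1). *)

Set Implicit Arguments.
Unset Strict Implicit.
Unset Printing Implicit Defensive.

Import GRing.Theory.
Local Open Scope ring_scope.

(** Injectivity suffices, as both sides have (n+1)! elements. It splits the permanent by the image
    of [i], giving the row expansion. *)
Lemma bij_lift_perm n (i : 'I_n.+1) :
  bijective (fun u : 'I_n.+1 * 'S_n => lift_perm i u.1 u.2).
Proof.
apply: inj_card_bij => [[j s] [j' s'] /= /permP eq_jj'|].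
  have:= eq_jj' i; rewrite !lift_perm_id => Dj; congr (_, _) => //.
  apply/permP=> k; have:= eq_jj' (lift i k).
  by rewrite !lift_perm_lift Dj => /lift_inj.
by rewrite card_prod !card_Sn card_ord -factS.
Qed.

Lemma expand_permanent_row (R : comNzRingType) n (A : 'M[R]_n.+1) i :
  permanent A = \sum_j A i j * permanent (row' i (col' j A)).
Proof.
rewrite /permanent (reindex _ (onW_bij _ (bij_lift_perm i))) /=.
rewrite -(pair_bigA _ (fun j s => \prod_k A k (lift_perm i j s k))) /=.
apply: eq_bigr => j _; rewrite big_distrr; apply: eq_bigr => s _.
rewrite (@bigD1_ord _ _ _ _ i) //= lift_perm_id; congr (_ * _).
by apply: eq_bigr => k _; rewrite lift_perm_lift !mxE.
Qed.

Lemma permanent_map (R S : comNzRingType) (f : {rmorphism R -> S}) n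
    (A : 'M[R]_n) :
  permanent (map_mx f A) = f (permanent A).
Proof.
rewrite rmorph_sum; apply: eq_bigr => s _; rewrite rmorph_prod.
by apply: eq_bigr => i _; rewrite mxE.
Qed.

Lemma row'_col'_addZ_delta (R : comNzRingType) n (A : 'M[R]_n.+1) t i j k :
  row' i (col' k (A + t *: delta_mx i j)) = row' i (col' k A).
Proof.
by apply/matrixP=> u v; rewrite !mxE eq_sym (negPf (neq_lift _ _)) mulr0 addr0.
Qed.

(** In the expansion along row [i], every minor omits that row, so only the coefficient at column
    [j] changes. *)
Lemma permanent_addZ_delta (R : comNzRingType) n (A : 'M[R]_n.+1) t i j :
  permanent (A + t *: delta_mx i j) =
    permanent A + t * permanent (row' i (col' j A)).
Proof.
rewrite !(expand_permanent_row _ i).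
under eq_bigr => k _ do rewrite row'_col'_addZ_delta !mxE eqxx mulrDl.
rewrite big_split; congr (_ + _).
rewrite (bigD1 j) //= eqxx mulr1 big1 ?addr0 // => k /negPf->.
by rewrite mulr0 mul0r.
Qed.

Lemma permanent11 (R : comNzRingType) (A : 'M[R]_1) : permanent A = A 0 0.
Proof.
rewrite /permanent (big_pred1 1%g) => [|s]; last by rewrite [s]permS1 /= eqxx.
by rewrite big_ord1 perm1.
Qed.

Lemma permanent22 (R : comNzRingType) (A : 'M[R]_2) :
  permanent A = A 0 0 * A 1 1 + A 0 1 * A 1 0.
Proof.
rewrite (expand_permanent_row _ 0) !big_ord_recl big_ord0 addr0.
rewrite !permanent11 !mxE.
by congr (A _ _ * A _ _ + A _ _ * A _ _); apply: val_inj.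
Qed.

(** Two distinct rows or columns are those left after deleting a third one, [k]. Their order may
    stay open: a 2x2 permanent is unchanged by swapping rows or columns. *)
Lemma lift_ord3 (i j : 'I_3) : i != j ->
  exists k : 'I_3, lift k 0 = i /\ lift k 1 = j \/ lift k 0 = j /\ lift k 1 = i.
Proof.
have lift_val (k u v : 'I_3) : (lift k 0 == u :> nat) && (lift k 1 == v :> nat) ->
    lift k 0 = u /\ lift k 1 = v.
  by case/andP => /eqP/val_inj-> /eqP/val_inj->.
case: i j => [[|[|[|//]]] lti] [[|[|[|//]]] ltj] // _;
  by [exists ord0; auto | exists 1; auto | exists ord_max; auto].
Qed.

(** The case 2 = 0 is separate because the other argument cancels a factor 2. *)
Lemma det3_eq0_of_permanent_minors (F : fieldType) (A : 'M[F]_3) :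
  (forall i j, permanent (row' i (col' j A)) = 0) -> \det A = 0.
Proof.
move=> minor0.
have [two0|two_neq0] := eqVneq (2%:R : F) 0.
  have perm0 : permanent A = 0.
    by rewrite (expand_permanent_row _ 0) big1 // => j _; rewrite minor0 mulr0.
  (* In characteristic 2 the determinant is the permanent. *)
  rewrite -perm0; apply: eq_bigr => s _.
  have -> : (-1 : F) = 1 by apply/eqP; rewrite eq_sym -addr_eq0 -mulr2n two0.
  by rewrite expr1n mul1r.
have minorE i i' j j' : i != i' -> j != j' ->
    A i j * A i' j' + A i j' * A i' j = 0.
  move=> /lift_ord3[k Dk] /lift_ord3[l Dl]; have:= minor0 k l.
  rewrite permanent22 !mxE.
  by case: Dk => -[-> ->]; case: Dl => -[-> ->] <-; ring.
(* Each transversal product x of the Leibniz expansion vanishes: modulo the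
   permanental minors, x^2 is divisible by a product a_j a_j' b_j'' of entries
   of two rows, and twice the latter is zero. *)
rewrite /(\det A) big1 // => s _.
rewrite !big_ord_recl big_ord0.
set r0 := ord0; set r1 := @lift 3 _ ord0; set r2 := @lift 3 _ (lift _ _).
have : [/\ s r0 != s r1, s r0 != s r2 & s r1 != s r2].
  by split; rewrite (inj_eq perm_inj).
move: (s r0) (s r1) (s r2) => j0 j1 j2 [n01 n02 n12].
have aab0 : A r0 j0 * A r0 j1 * A r1 j2 = 0.
  apply: (mulfI two_neq0); rewrite mulr0.
  have -> : 2%:R * (A r0 j0 * A r0 j1 * A r1 j2) =
      A r0 j0 * (A r0 j1 * A r1 j2 + A r0 j2 * A r1 j1)
    - A r0 j2 * (A r0 j0 * A r1 j1 + A r0 j1 * A r1 j0)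
    + A r0 j1 * (A r0 j0 * A r1 j2 + A r0 j2 * A r1 j0) by ring.
  by rewrite !minorE //; ring.
suff -> : A r0 j0 * (A r1 j1 * (A r2 j2 * 1)) = 0 by rewrite mulr0.
apply/eqP; rewrite -sqrf_eq0; apply/eqP; rewrite mulr1.
set x := A r0 j0 * _.
have -> : x ^+ 2 =
    x * A r2 j2 * (A r0 j0 * A r1 j1 + A r0 j1 * A r1 j0)
  - x * A r0 j1 * (A r1 j0 * A r2 j2 + A r1 j2 * A r2 j0)
  + A r0 j0 * A r0 j1 * A r1 j2 * (A r1 j1 * A r2 j0 * A r2 j2).
  by rewrite /x; ring.
by rewrite !minorE // aab0; ring.
Qed.

(** Each fibre is a coset of the kernel: with a section [s] of [h], the map (u, w) to u + s w is a
    bijection from kernel times [B] onto the preimage. *)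
Lemma card_preim_additive (V W : finZmodType) (h : {additive V -> W})
    (B : {set W}) :
  (forall w, exists v, h v = w) ->
  #|[set v | h v \in B]| = (#|[set v | h v == 0%R]| * #|B|)%N.
Proof.
move=> h_surj; have h_surjb w : [exists v, h v == w].
  by have [v <-] := h_surj w; apply/existsP; exists v.
pose s w := xchoose (existsP (h_surjb w)).
have hs w : h (s w) = w by apply/eqP/(xchooseP (existsP (h_surjb w))).
rewrite -cardsX -(card_in_imset (f := fun u => u.1 + s u.2)) => [|[v w] [v' w']].
  apply: eq_card => v; rewrite inE; apply/idP/imsetP => [hvB|[[u w]]].
    exists (v - s (h v), h v); last by rewrite /= subrK.
    by rewrite !inE /= raddfB /= hs subrr eqxx.
  by rewrite !inE /= => /andP[/eqP hu wB] ->; rewrite raddfD /= hu hs add0r.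
rewrite !inE /= => /andP[/eqP hv _] /andP[/eqP hv' _] eq_vw.
have := congr1 h eq_vw; rewrite !raddfD /= hv hv' !hs !add0r => Dw.
by move: eq_vw; rewrite Dw => /addIr->.
Qed.

(** Plain matrices instead of elements of GL, so that [map_mx f] and the additive fibre count
    apply. *)
Definition perm0_unitmx (R : finComUnitRingType) n : {set 'M[R]_n} :=
  [set A | (A \in unitmx) && (permanent A == 0)].

(* The bijection sends (A, t) to A with t added at the position of a minor
   whose image under f is a unit; neither the position nor the minor changes. *)
Lemma card_perm0_unitmx_lift (R S : finComUnitRingType)
    (f : {rmorphism R -> S}) n :
    (forall x, (f x \is a GRing.unit) = (x \is a GRing.unit)) ->
    (forall A : 'M[S]_n.+1, A \in perm0_unitmx S n.+1 ->
      exists u : 'I_n.+1 * 'I_n.+1,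
        permanent (row' u.1 (col' u.2 A)) \is a GRing.unit) ->
  #|[set A : 'M[R]_n.+1 | map_mx f A \in perm0_unitmx S n.+1]| =
    (#|perm0_unitmx R n.+1| * #|[set t | f t == 0%R]|)%N.
Proof.
move=> unit_f has_minor.
pose minor n (T : comUnitRingType) u (A : 'M[T]_n.+1) :=
  permanent (row' u.1 (col' u.2 A)).
(* The position depends on [A] only through its image under [f]. The default is never reached when
   that image lies in [perm0_unitmx]. *)
pose pos A := odflt (ord0, ord0)
  [pick u | minor n S u (map_mx f A) \is a GRing.unit].
pose shift (w : 'M[R]_n.+1 * R) := w.1 + w.2 *: delta_mx (pos w.1).1 (pos w.1).2.
have f_shift w : f w.2 = 0 -> map_mx f (shift w) = map_mx f w.1.
  by move=> fw0; rewrite map_mxD map_mxZ fw0 scale0r addr0.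
have minor_shift t u A : minor n R u (A + t *: delta_mx u.1 u.2) = minor n R u A.
  by rewrite /minor row'_col'_addZ_delta.
have minor_unit A : map_mx f A \in perm0_unitmx S n.+1 ->
    minor n R (pos A) A \is a GRing.unit.
  move=> /has_minor[u Au]; rewrite -unit_f /pos /minor.
  rewrite -permanent_map map_row' map_col'.
  by case: pickP => //= /(_ u); rewrite /minor Au.
have unitmx_f A : (map_mx f A \in unitmx) = (A \in unitmx).
  by rewrite !unitmxE det_map_mx unit_f.
have perm0_f A : A \in perm0_unitmx R n.+1 ->
    map_mx f A \in perm0_unitmx S n.+1.
  rewrite !inE unitmx_f permanent_map => /andP[-> /eqP->].
  by rewrite rmorph0 eqxx.
rewrite -cardsX -(card_in_imset (f := shift)) => [|[A t] [A' t']].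
  apply: eq_card => B; rewrite inE; apply/idP/imsetP => [fB|[[A t]]].
    (* This [t] solves [permanent B - t * minor = 0]; it lies in the kernel because [f] kills
       [permanent B]. *)
    have uB := minor_unit B fB; pose t := permanent B / minor n R (pos B) B.
    have ft0 : f t = 0.
      move: fB; rewrite inE permanent_map => /andP[_ /eqP pB].
      by rewrite rmorphM pB mul0r.
    pose A := shift (B, - t).
    have fA : map_mx f A = map_mx f B by rewrite f_shift // rmorphN /= ft0 oppr0.
    have posA : pos A = pos B by rewrite /pos fA.
    exists (A, t); last by rewrite /shift /= posA /A /shift /= scaleNr subrK.
    rewrite !inE /= ft0 eqxx andbT -unitmx_f fA.
    move: fB; rewrite inE => /andP[-> _] /=.
    by rewrite permanent_addZ_delta mulNr divrK // subrr.
  rewrite inE /= [t \in _]inE => /andP[/perm0_f fA /eqP ft0] ->.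
  by rewrite f_shift.
rewrite !inE /= -!andbA.
move=> /and3P[uA /eqP pA /eqP ft] /and3P[uA' /eqP pA' /eqP ft'] eqA.
have fAA' : map_mx f A = map_mx f A'.
  by have := congr1 (map_mx f) eqA; rewrite !f_shift.
have pos_eq : pos A = pos A' by rewrite /pos fAA'.
have minor_eq : minor n R (pos A) A = minor n R (pos A) A'.
  by have := congr1 (minor n R (pos A)) eqA; rewrite /shift /= -pos_eq !minor_shift.
(* Both permanents being 0, this reads t m = t' m for the common minor m, a unit. *)
have := congr1 (@permanent _ _) eqA.
rewrite /shift /= -pos_eq !permanent_addZ_delta pA pA' !add0r.
rewrite -![permanent _]/(minor n R (pos A) _) -minor_eq.
have uAm : minor n R (pos A) A \is a GRing.unit.
  by apply/minor_unit/perm0_f; rewrite inE uA pA eqxx.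
move/(mulIr uAm) => Dt; move: eqA.
by rewrite /shift /= -pos_eq Dt => /addIr->.
Qed.

Lemma card_GL_perm0 (R : finComUnitRingType) n :
  #|[set M : {'GL_n.+1[R]} | permanent (GLval M) == 0%R]| = #|perm0_unitmx R n.+1|.
Proof.
rewrite -(card_imset _ val_inj); apply: eq_card => A; rewrite !inE.
apply/imsetP/andP => [[M /[!inE] pM ->]|[uA pA]].
  by split; [exact: (valP M) | exact: pM].
by exists (FinRing.Unit uA); rewrite ?inE.
Qed.

Lemma perm0_unitmx3_unit_minor (F : finFieldType) (A : 'M[F]_3) :
  A \in perm0_unitmx F 3 ->
  exists u : 'I_3 * 'I_3, permanent (row' u.1 (col' u.2 A)) \is a GRing.unit.
Proof.
rewrite inE unitmxE unitfE => /andP[detA _]; apply/existsP; apply: contraNT detA.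
move/existsPn => minor0; apply/eqP/det3_eq0_of_permanent_minors => i j.
by apply/eqP; move: (minor0 (i, j)); rewrite unitfE negbK.
Qed.

(** Reducing representatives is compatible with the operations since p divides p^k; on either side,
    being a unit means being coprime to p. *)
Lemma exists_Zp_reduction p k : prime p -> (0 < k)%N ->
  exists f : {rmorphism 'Z_(p ^ k) -> 'F_p},
    (forall y, exists x, f x = y) /\
    (forall x, (f x \is a GRing.unit) = (x \is a GRing.unit)).
Proof.
move=> p_pr k_gt0; have p_gt1 := prime_gt1 p_pr.
have q_gt1 : (1 < p ^ k)%N by rewrite -(expn0 p) ltn_exp2l.
pose f (x : 'Z_(p ^ k)) : 'F_p := (nat_of_ord x)%:R.
have f_nat m : f m%:R = m%:R.
  by rewrite /f val_Zp_nat // -[LHS]Fp_nat_mod // modn_dvdm ?dvdn_exp // Fp_nat_mod.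
have f_add x y : f (x + y) = f x + f y.
  by rewrite -[x]natr_Zp -[y]natr_Zp -natrD !f_nat natrD.
have f_zmod : zmod_morphism f.
  by move=> x y; apply: (canRL (addrK _)); rewrite -f_add subrK.
have f_monoid : monoid_morphism f.
  split; first exact: (f_nat 1%N).
  by move=> x y; rewrite -[x]natr_Zp -[y]natr_Zp -natrM !f_nat natrM.
pose fA := GRing.isZmodMorphism.Build _ _ f f_zmod.
pose fM := GRing.isMonoidMorphism.Build _ _ f f_monoid.
pose fR : {rmorphism 'Z_(p ^ k) -> 'F_p} := HB.pack f fA fM.
exists fR; split => [y|x].
  by exists (nat_of_ord y)%:R; rewrite /= f_nat natr_Zp.
by rewrite -[x]natr_Zp /= f_nat unitFpE // unitZpE // coprime_pexpl.
Qed.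

Theorem theorem3 (p k : nat) (hp : prime p) (hk : (0 < k)%N) :
  g (p ^ k)%N 0%Z = (p ^ (8 * (k - 1)) * g p 0%Z)%N.
Proof.
have [f [f_surj f_unit]] := exists_Zp_reduction hp hk.
have p_gt0 := prime_gt0 hp.
have card_R : #|'Z_(p ^ k)| = (p ^ k)%N.
  by rewrite card_ord Zp_cast // -(expn0 p) ltn_exp2l ?prime_gt1.
have card_ker : #|[set t | f t == 0]| = (p ^ (k - 1))%N.
  have := card_preim_additive [set: 'F_p] f_surj.
  have -> : [set v | f v \in [set: 'F_p]] = setT by apply/setP=> x; rewrite !inE.
  rewrite !cardsT card_Fp // card_R -{1}(subnK hk) expnD expn1.
  by move/eqP; rewrite eqn_pmul2r // => /eqP.
have mx_surj (N : 'M['F_p]_3) : exists M, map_mx f M = N.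
  have [s fs] := fin_all_exists (fun ij : 'I_3 * 'I_3 => f_surj (N ij.1 ij.2)).
  by exists (\matrix_(i, j) s (i, j)); apply/matrixP=> i j; rewrite !mxE fs.
have card_mx_ker : #|[set M : 'M_3 | map_mx f M == 0]| = (p ^ (9 * (k - 1)))%N.
  have := card_preim_additive [set: 'M['F_p]_3] mx_surj.
  have -> : [set v | map_mx f v \in [set: 'M['F_p]_3]] = setT
    by apply/setP=> x; rewrite !inE.
  rewrite !cardsT !card_mx card_Fp // card_R -!expnM -{1}(subnK hk).
  rewrite mulnDl expnD.
  rewrite mul1n => /eqP; rewrite eqn_pmul2r ?expn_gt0 ?p_gt0 // mulnC.
  by move/eqP.
have := card_perm0_unitmx_lift f_unit (@perm0_unitmx3_unit_minor 'F_p).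
rewrite (card_preim_additive _ mx_surj) card_mx_ker card_ker -!card_GL_perm0.
(* ['F_p] stands for ['Z_(pdiv p)], so [p] must become [pdiv p] before [g] unfolds to a count over
   ['F_p]. *)
rewrite -[in g p _](pdiv_id hp).
rewrite -[g _ _]/#|[set M : {'GL_3['Z_(p ^ k)]} | permanent (GLval M) == 0%R]|.
rewrite -[g _ _]/#|[set M : {'GL_3['F_p]} | permanent (GLval M) == 0%R]|.
(* One of the nine factors p^(k-1), one per entry, cancels against the number of shifts [t]. *)
have -> : (9 * (k - 1) = 8 * (k - 1) + (k - 1))%N by rewrite -mulSnr.
rewrite expnD mulnAC => /eqP; rewrite eqn_pmul2r ?expn_gt0 ?p_gt0 // => /eqP.
by move=> ->.
Qed.
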